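(* Let $\mathcal{G}(\pi)=(V,E,\pi)$ be a colored directed graph with leader set $V_L\subseteq V$. If $V_L$ is a zero forcing set for $\mathcal{G}(\pi)$, then $(\mathcal{G}(\pi);V_L)$ is controllable.
   Context: Directed graphs $\mathcal{G}=(V,E)$ are simple: $V=\{1,\dots,n\}$, $E\subseteq V\times V$, and $E$ contains no edge $(i,i)$. A colored directed graph $\mathcal{G}(\pi)=(V,E,\pi)$ is a directed graph with a partition $\pi=\{E_1,\dots,E_k\}$ of $E$; edges in $E_r$ are said to have color $c_r$. Controllability. The qualitative class is $\mathcal{Q}(\mathcal{G})=\{A\in\mathbb{R}^{n\times n}\mid \text{for } i\neq j:\ A_{ij}\neq 0 \text{ iff } (j,i)\in E\}$ (diagonal entries are arbitrary reals), and the colored qualitative class is $\mathcal{Q}_\pi(\mathcal{G})=\{A\in\mathcal{Q}(\mathcal{G})\mid A_{ij}=A_{kl}\text{ if }(j,i),(l,k)\in E_r\text{ for some }r\}$. For a leader set $V_L=\{v_1,\dots,v_m\}\subseteq V$, let $B=B(V;V_L)\in\mathbb{R}^{n\times m}$ with $B_{ij}=1$ if $i=v_j$ and $B_{ij}=0$ otherwise. $(\mathcal{G}(\pi);V_L)$ is called controllable if the pair $(A,B)$ is controllable (in the classical sense for $\dot x=Ax+Bu$) for all $A\in\mathcal{Q}_\pi(\mathcal{G})$. Associated colored bipartite graphs. For disjoint $X=\{x_1,\dots,x_s\}$, $Y=\{y_1,\dots,y_t\}\subseteq V$, the associated colored bipartite graph has edge set $E_{XY}=\{\{x_i,y_j\}\mid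 (x_i,y_j)\in E\}$, where $\{x_i,y_j\}$ inherits the color of $(x_i,y_j)$. If $s=t$, a perfect matching is a set of edges $\{\{x_1,y_{\gamma(1)}\},\dots,\{x_t,y_{\gamma(t)}\}\}\subseteq E_{XY}$ with $\gamma$ a permutation of $(1,\dots,t)$; its sign is the sign of $\gamma$; its spectrum is the multiset of colors of its edges. Two perfect matchings are equivalent if they have the same spectrum, and the signature of an equivalence class is the sum of the signs of the perfect matchings in it. Color change rule and zero forcing. A coloring set $C\subseteq V$ is the set of vertices initially colored black; all others are white. For $X\subseteq C$, $N_{V\setminus C}(X)=\{j\in V\setminus C\mid \exists\, i\in X:\ (i,j)\in E\}$. For $X\subseteq C$ and $Y\subseteq V$ with $|X|=|Y|$, $Y$ is a color-perfect white neighbor of $X$ if (1) $Y=N_{V\setminus C}(X)$, and (2) in the colored bipartite graph associated with $X,Y$ there exists a perfect matching and exactly one equivalence class of perfect matchings has nonzero signature. Color change rule: if $C$ is the current set of black vertices, $X\subseteq C$, and $Y$ is a color-perfect white neighbor of $X$, then color all vertices in $Y$ black; write $X\xrightarrow{c}Y$. A derived set $\mathcal{D}_c(C)$ is a set of black vertices obtained from $C$ by repeated application of the color change rule until no more changes are possible (it need not be unique). $C$ is a zero forcing set for $\mathcal{G}(\pi)$ if there exists a derived set $\mathcal{D}_c(C)$ with $\mathcal{D}_c(C)=V$. *)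

(* Defs.v *)
From HB Require Import structures.
From Stdlib Require Import Relation_Operators.
From mathcomp Require Import all_boot all_order all_fingroup all_algebra.
From mathcomp Require Import finmap multiset.

Set Implicit Arguments.
Unset Strict Implicit.
Unset Printing Implicit Defensive.

Import Order.TTheory GRing.Theory Num.Theory.
Local Open Scope ring_scope.

Record colored_digraph (n : nat) := ColoredDigraph {
  edges : {set 'I_n * 'I_n};
  edges_irrefl : forall i, (i, i) \notin edges;
  colors : {set {set 'I_n * 'I_n}};
  colors_partition : partition colors edges
}.

(* A color is identified with the block of the partition carrying it. *)
Definition edge_color n (G : colored_digraph n) (e : 'I_n * 'I_n)
  : {set 'I_n * 'I_n} := pblock (colors G) e.

Section PerfectMatchings.
Variables (n : nat) (G : colored_digraph n) (X Y : {set 'I_n}).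
Hypothesis eqXY : #|X| = #|Y|.

(* x_i and y_i are listed by the canonical enumerations of X and Y; reordering
   them multiplies all signs by a common factor. *)
Definition bip_edge (g : 'S_#|X|) (i : 'I_#|X|) : 'I_n * 'I_n :=
  (enum_val i, enum_val (cast_ord eqXY (g i))).

(* The perfect matching {x_i, y_(g i)} is represented by g. *)
Definition perfect_matchings : {set 'S_#|X|} :=
  [set g : 'S_#|X| | [forall i, bip_edge g i \in edges G]].

Definition spectrum (g : 'S_#|X|) : {mset {set 'I_n * 'I_n}}%mset :=
  seq_mset [seq edge_color G (bip_edge g i) | i <- enum 'I_#|X|].

Definition matching_classes : {set {set 'S_#|X|}} :=
  equivalence_partition (fun g h => spectrum g == spectrum h)
    perfect_matchings.

Definition signature (K : {set 'S_#|X|}) : int := \sum_(g in K) (-1) ^+ g.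

Definition unique_nonzero_signature : Prop :=
  #|[set K in matching_classes | signature K != 0]| = 1%N.
End PerfectMatchings.

Definition white_neighbors n (G : colored_digraph n) (C X : {set 'I_n})
  : {set 'I_n} := [set j in ~: C | [exists i in X, (i, j) \in edges G]].

Definition color_perfect_white_neighbor n (G : colored_digraph n)
    (C X Y : {set 'I_n}) : Prop :=
  exists eqXY : #|X| = #|Y|,
    [/\ Y = white_neighbors G C X,
        exists g, g \in perfect_matchings G eqXY
      & unique_nonzero_signature G eqXY].

Definition color_change n (G : colored_digraph n) (C C' : {set 'I_n}) : Prop :=
  exists X Y : {set 'I_n}, [/\ X \subset C,
    color_perfect_white_neighbor G C X Y & C' = C :|: Y].

Definition derived_set n (G : colored_digraph n) (C D : {set 'I_n}) : Prop :=
  clos_refl_trans _ (color_change G) C D /\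
  forall D', color_change G D D' -> D' = D.

Definition zero_forcing_set n (G : colored_digraph n) (C : {set 'I_n}) : Prop :=
  exists D, derived_set G C D /\ D = [set: 'I_n].

(* Imported only here: classical_sets shadows partition, pblock, ... of finset. *)
From mathcomp Require Import all_classical all_reals all_analysis.
Import numFieldNormedType.Exports.

(* Note the transposition: A i j is the weight of the edge (j, i). *)
Definition qualitative_class (R : realType) n (G : colored_digraph n)
    (A : 'M[R]_n) : Prop :=
  forall i j, i != j -> A i j != 0 <-> (j, i) \in edges G.

Definition colored_qualitative_class (R : realType) n (G : colored_digraph n)
    (A : 'M[R]_n) : Prop :=
  qualitative_class G A /\
  forall (Er : {set 'I_n * 'I_n}) (i j k l : 'I_n), Er \in colors G ->
    (j, i) \in Er -> (l, k) \in Er -> A i j = A k l.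

(* The leaders v_1, ..., v_m are listed by the canonical enumeration of VL. *)
Definition leader_mx (R : realType) n (VL : {set 'I_n}) : 'M[R]_(n, #|VL|) :=
  \matrix_(i, j) (i == enum_val j)%:R.

(* Inputs are continuous. Measurable locally integrable or piecewise continuous
   inputs would give the same notion of controllability. *)
Definition trajectory (R : realType) n m (A : 'M[R]_n) (B : 'M[R]_(n, m))
    (u : R -> 'cV[R]_m) (x : R -> 'cV[R]_n) : Prop :=
  continuous u /\ forall t : R, is_derive t 1 x (A *m x t + B *m u t).

Definition controllable_pair (R : realType) n m (A : 'M[R]_n)
    (B : 'M[R]_(n, m)) : Prop :=
  forall x0 x1 : 'cV[R]_n, exists T : R, 0 < T /\
    exists u x, [/\ trajectory A B u x, x 0 = x0 & x T = x1].

Definition controllable (R : realType) n (G : colored_digraph n)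
    (VL : {set 'I_n}) : Prop :=
  forall A : 'M[R]_n, colored_qualitative_class G A ->
    controllable_pair A (leader_mx R VL).

(* Main.v *)
Require Import Defs.
From Stdlib Require Import Relation_Operators.
From mathcomp Require Import all_boot all_algebra.
From mathcomp Require Import all_fingroup.
From mathcomp Require Import finmap multiset.
From mathcomp Require Import all_classical all_reals all_analysis.
From mathcomp Require Import fintype finset ring.
Import numFieldNormedType.Exports.

(** The proof has a combinatorial half, which shows that no nonzero row vector
    is orthogonal to all the columns of B, AB, A^2 B and so on, and an
    analytic half, which turns this into an explicit polynomial steering law.

    Combinatorial half. Let X be black and Y a color-perfect white neighbor of
    X. In the Leibniz expansion of det A[Y, X] the nonzero terms are the perfect
    matchings; two matchings with the same spectrum carry the same product of
    weights, so each equivalence class contributes its signature times a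
    nonzero number. Exactly one signature is nonzero, hence so is the
    determinant ([pattern_minor_det_neq0]). If w and wA both vanish on the
    black set, the entries of wA at X read w_Y A[Y, X] = 0, since X has no white
    out-neighbor outside Y; hence w vanishes on Y too ([color_change_kernel]).
    A chain of color changes from the leaders to V therefore forces w = 0 as
    soon as w A^k B = 0 for sufficiently many k ([zero_forcing_unobservable]).
    Working with powers of A rather than eigenvectors keeps everything over
    the reals.

    Analytic half. Duality gives matrices K_k with sum_k A^k B K_k = 1
    ([kalman_right_inverse]). Write D for the time derivative. As D - A
    divides D^k - A^k, the equation Dy - Ay = A^k B g + Bv has a solution in
    which y and v are combinations of derivatives of g ([forced_response]);
    summing over k solves Dy - Ay = f + Bv for every polynomial f, with y
    vanishing wherever f vanishes to high order. Apply this to the defect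
    f = Dx - Ax of a polynomial curve x from x0 to x1 that satisfies Dx = Ax to
    high order at both ends ([flat_connection]): x - y is a trajectory
    for the input -v with the same end points as x
    ([kalman_controllable]). No matrix exponential is involved. *)

Set Implicit Arguments.
Unset Strict Implicit.
Unset Printing Implicit Defensive.

Import GRing.Theory Num.Theory.
Local Open Scope ring_scope.

(** * Determinants of color-perfect blocks *)

Section PatternMinor.
Variables (R : realType) (n : nat) (G : colored_digraph n) (A : 'M[R]_n).
Hypothesis A_G : colored_qualitative_class G A.
Variables (X Y : {set 'I_n}) (eqXY : #|X| = #|Y|).

(** The common weight of the edges of a color, read off an arbitrary one of
    them. The value on the empty block is a dummy. *)
Definition color_weight (c : {set 'I_n * 'I_n}) : R :=
  if [pick e in c] is Some e then A e.2 e.1 else 0.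

Lemma color_weightE e :
  e \in edges G -> color_weight (edge_color G e) = A e.2 e.1.
Proof.
move=> eE; rewrite /color_weight /edge_color.
have /and3P[/eqP covG _ _] := colors_partition G.
have ec : e \in cover (colors G) by rewrite covG.
case: pickP => [e' e'c | /(_ e)]; last by rewrite /= mem_pblock ec.
case: e e' {eE} ec e'c => [a b] [a' b'] /= ec e'c.
by apply: (A_G.2 _ _ _ _ _ (pblock_mem ec)); rewrite // mem_pblock.
Qed.

(** The transpose of the block A[Y, X], so that the term of a permutation in
    its Leibniz expansion is the product of the weights along [bip_edge]. *)
Definition pattern_minor : 'M[R]_#|X| :=
  \matrix_(i, j) A (enum_val (cast_ord eqXY j)) (enum_val i).

(** The weight of an edge depends on its color alone, so the product over a
    matching is a function of the multiset of colors. *)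
Lemma eq_spectrum_prod g h :
    g \in perfect_matchings G eqXY -> h \in perfect_matchings G eqXY ->
    spectrum G eqXY g = spectrum G eqXY h ->
  \prod_i pattern_minor i (g i) = \prod_i pattern_minor i (h i).
Proof.
have prodE k : k \in perfect_matchings G eqXY ->
    \prod_i pattern_minor i (k i) =
    \prod_(c <- [seq edge_color G (bip_edge eqXY k i) | i <- enum 'I_#|X|])
      color_weight c.
  rewrite inE => /forallP kE; rewrite big_map big_enum; apply: eq_bigr => i _.
  by rewrite color_weightE // mxE.
move=> /prodE-> /prodE-> /eq_seq_msetP; exact: perm_big.
Qed.

(** Disjointness keeps the diagonal of A, on which the class puts no
    condition, out of the block. *)
Lemma pattern_minor_det_neq0 : [disjoint X & Y] ->
  unique_nonzero_signature G eqXY -> \det pattern_minor != 0.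
Proof.
move=> dXY /eqP/cards1P[K0 K0E].
have [K0M K0n0] : K0 \in matching_classes G eqXY /\ signature K0 != 0.
  by apply/andP; have := set11 K0; rewrite -K0E inE.
have eqvS : {in perfect_matchings G eqXY & &,
    equivalence_rel (fun g h => spectrum G eqXY g == spectrum G eqXY h)}.
  by move=> f g h _ _ _; split => [|/eqP->].
have partP := equivalence_partitionP eqvS.
have offdiag (i j : 'I_#|X|) :
    enum_val (cast_ord eqXY j) != enum_val i.
  apply/negP => /eqP e; have := disjointFr dXY (enum_valP i).
  by rewrite -e enum_valP.
rewrite /determinant (bigID (mem (perfect_matchings G eqXY))) /=.
rewrite [X in _ + X]big1 ?addr0; last first.
  move=> g; rewrite inE negb_forall => /existsP[i giNE].
  suff gi0 : pattern_minor i (g i) = 0 by rewrite (bigD1 i) //= gi0 mul0r mulr0.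
  by rewrite mxE; apply: contraNeq giNE => /(A_G.1 _ _ (offdiag _ _)).
rewrite (set_partition_big _ partP) /=.
(* The sum over a class factors as its signature times a common product. *)
have classE K : K \in matching_classes G eqXY -> exists2 a : R,
    \sum_(g in K) (-1) ^+ g * \prod_i pattern_minor i (g i) =
    (signature K)%:~R * a &
    exists2 g, g \in K & a = \prod_i pattern_minor i (g i).
  move=> KM; have /and3P[/eqP covM tM n0M] := partP.
  have /set0Pn[g gK] : K != set0 by apply: contraNneq n0M => <-.
  have sub h : h \in K -> h \in perfect_matchings G eqXY.
    by move=> hK; rewrite -covM; apply/bigcupP; exists K.
  exists (\prod_i pattern_minor i (g i)); last by exists g.
  rewrite /signature rmorph_sum mulr_suml; apply: eq_bigr => h hK.
  rewrite rmorphXn rmorphN1; congr (_ * _).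
  apply: eq_spectrum_prod; try exact: sub.
  apply/eqP; rewrite eq_sym.
  rewrite -(pblock_equivalence_partition eqvS (sub _ gK) (sub _ hK)).
  by rewrite (def_pblock tM KM gK).
rewrite (bigD1 K0) //= [X in _ + X]big1 ?addr0; last first.
  move=> K /andP[KM KK0].
  have [a -> _] := classE K KM.
  have : K \notin [set K0] by rewrite inE.
  by rewrite -K0E inE KM /= negbK => /eqP->; rewrite mul0r.
have [a -> [g gK ->]] := classE K0 K0M.
rewrite mulf_neq0 ?intr_eq0 //; apply/prodf_neq0 => i _.
have : g \in perfect_matchings G eqXY.
  by have /and3P[/eqP <- _ _] := partP; apply/bigcupP; exists K0.
by rewrite inE => /forallP/(_ i)/(A_G.1 _ _ (offdiag _ _)); rewrite mxE.
Qed.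

End PatternMinor.

(** * Zero forcing kills unobservable row vectors *)

(** Black out-neighbors of X contribute nothing to (wA)_x because w vanishes
    there, and white ones all lie in Y; so wA = 0 on X is the square
    homogeneous system of [pattern_minor] in the unknowns w_Y. *)
Lemma color_change_kernel (R : realType) n (G : colored_digraph n)
    (A : 'M[R]_n) (C C' : {set 'I_n}) (w : 'rV[R]_n) :
  colored_qualitative_class G A -> color_change G C C' ->
  {in C, forall i, w 0 i = 0} -> {in C, forall i, (w *m A) 0 i = 0} ->
  {in C', forall i, w 0 i = 0}.
Proof.
move=> A_G [X [Y [XC [eqXY [YE _ uXY]] ->]]] wC wAC i.
rewrite inE => /orP[/wC //|iY].
have dXY : [disjoint X & Y].
  apply/pred0Pn => -[j /andP[jX]] /=; rewrite YE !inE => /andP[jC _].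
  by rewrite (fintype.subsetP XC) in jC.
pose z : 'cV_#|X| := \col_j w 0 (enum_val (cast_ord eqXY j)).
suff z0 : z = 0.
  have iE : cast_ord eqXY (cast_ord (esym eqXY) (enum_rank_in iY i)) =
    enum_rank_in iY i by rewrite cast_ordKV.
  have /colP/(_ (cast_ord (esym eqXY) (enum_rank_in iY i))) := z0.
  by rewrite !mxE iE enum_rankK_in.
have Mu : pattern_minor A eqXY \in unitmx.
  by rewrite unitmxE unitfE; apply: pattern_minor_det_neq0 uXY.
apply: (can_inj (mulKmx Mu)); rewrite mulmx0.
apply/colP => k; have xX := enum_valP k; set x := enum_val k in xX *.
have := wAC x (fintype.subsetP XC _ xX); rewrite !mxE => wx0.
rewrite -[RHS]wx0 [RHS](bigID (mem Y)) /=.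
rewrite [X in _ = _ + X]big1 ?addr0; last first.
  move=> j jY; have [/wC->|jC] := boolP (j \in C); first by rewrite mul0r.
  have [->|Ajx] := eqVneq (A j x) 0; first by rewrite mulr0.
  have jx : j != x by apply: contraNneq jC => ->; exact: (fintype.subsetP XC).
  case/negP: jY; rewrite YE !inE jC; apply/existsP; exists x.
  by rewrite xX; apply/(A_G.1 _ _ jx).
rewrite [RHS]big_enum_val (reindex (cast_ord eqXY)) /=; last first.
  by exists (cast_ord (esym eqXY)) => ? _; rewrite ?cast_ordK ?cast_ordKV.
by apply: eq_bigr => j _; rewrite !mxE mulrC.
Qed.

(** N is one more than the number of color changes: each of them consumes the
    knowledge that wA, besides w, vanishes on the current black set. *)
Lemma zero_forcing_unobservable (R : realType) n (G : colored_digraph n)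
    (A : 'M[R]_n) (VL : {set 'I_n}) :
  colored_qualitative_class G A -> zero_forcing_set G VL ->
  exists N, forall w : 'rV[R]_n,
    (forall k, (k < N)%N -> w *m iter k (mulmx A) (leader_mx R VL) = 0) ->
    w = 0.
Proof.
move=> A_G [D [[VLD _] DT]].
pose B := leader_mx R VL.
pose killed (C : {set 'I_n}) := exists N, forall w : 'rV[R]_n,
  (forall k, (k < N)%N -> w *m iter k (mulmx A) B = 0) ->
  {in C, forall i, w 0 i = 0}.
suff [N NP] : killed D.
  by exists N => w /NP wD; apply/rowP => i; rewrite wD ?DT ?inE // mxE.
have : killed VL.
  exists 1%N => w /(_ 0%N isT) /= wB i iVL.
  have /rowP/(_ (enum_rank_in iVL i)) := wB; rewrite !mxE (bigD1 i) //=.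
  rewrite mxE enum_rankK_in // eqxx mulr1 big1 ?addr0 // => j ji.
  by rewrite mxE enum_rankK_in // (negPf ji) mulr0.
elim: VLD => [C C' CC' [N NP] | // | C1 C2 C3 _ IH12 _ IH23 /IH12/IH23 //].
exists N.+1 => w wN; apply: (color_change_kernel A_G CC').
- by apply: NP => k kN; apply: wN; apply: leqW.
- by apply: NP => k kN; rewrite -mulmxA; apply: (wN k.+1).
Qed.

(** * From Kalman's condition to polynomial steering *)

(** Row vectors orthogonal to all columns of the A^k B are trivial, so these
    columns span the whole space, and the identity is a combination of them. *)
Lemma kalman_right_inverse (F : fieldType) n m (A : 'M[F]_n)
    (B : 'M[F]_(n, m)) N :
  (forall w : 'rV[F]_n,
    (forall k, (k < N)%N -> w *m iter k (mulmx A) B = 0) -> w = 0) ->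
  exists K : 'I_N -> 'M[F]_(m, n),
    \sum_(k < N) iter k (mulmx A) B *m K k = 1%:M.
Proof.
move=> obs; pose S k := (iter k (mulmx A) B)^T.
pose T := (\sum_(k < N) <<S k>>)%MS.
have /sub_sumsmxP[u uE] : (1%:M <= T)%MS.
  rewrite submxE mul1mx -trmx_eq0; apply/eqP/row_matrixP => i; rewrite row0.
  apply: obs => k kN; rewrite -row_mul -[iter _ _ _]trmxK -trmx_mul.
  suff /eqP-> : (S k *m cokermx T == 0)%R by rewrite trmx0 row0.
  by rewrite -submxE (sumsmx_sup (Ordinal kN)) // genmxE.
exists (fun k => (u k *m (<<S k>>%MS *m pinvmx (S k)))^T).
apply: trmx_inj; rewrite trmx1 uE raddf_sum; apply: eq_bigr => k _ /=.
by rewrite trmx_mul trmxK -mulmxA mulmxKpV // genmxE.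
Qed.

Section PolynomialTrajectories.
Variable R : realType.

Local Notation pderiv := (map_mx (@deriv R)).
Local Notation pconst := (map_mx (@polyC R)).
Local Notation peval t := (map_mx (horner_eval t)).
(** Divisibility rather than vanishing derivatives, so that flatness is
    visibly inherited by multiples. *)
Definition flat_at p q (c : R) (m : nat) (x : 'M[{poly R}]_(p, q)) :=
  forall i j, ('X - c%:P) ^+ m %| x i j.

Lemma pderiv_const_mul p q r (a : 'M[R]_(p, q)) (x : 'M[{poly R}]_(q, r)) :
  pderiv (pconst a *m x) = pconst a *m pderiv x.
Proof.
apply/matrixP => i j; rewrite !mxE raddf_sum.
by apply: eq_bigr => k _; rewrite /= derivM !mxE derivC mul0r add0r.
Qed.

Lemma pderiv_scale p q (a : {poly R}) (x : 'M[{poly R}]_(p, q)) :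
  pderiv (a *: x) = a^`() *: x + a *: pderiv x.
Proof. by apply/matrixP => i j; rewrite !mxE derivM. Qed.

Lemma peval_const_mul p q r t (a : 'M[R]_(p, q)) (x : 'M[{poly R}]_(q, r)) :
  peval t (pconst a *m x) = a *m peval t x.
Proof.
rewrite map_mxM /=; congr (_ *m _).
by apply/matrixP => i j; rewrite !mxE /= horner_evalE hornerC.
Qed.

Lemma dvdp_XsubC_exp_root (c : R) m (p : {poly R}) :
  ('X - c%:P) ^+ m.+1 %| p -> p.[c] = 0.
Proof.
move=> pc; apply/rootP; rewrite -dvdp_XsubCl; apply: dvdp_trans pc.
by rewrite exprS dvdp_mulr.
Qed.

Lemma dvdp_deriv_XsubC_exp (c : R) m (p : {poly R}) :
  ('X - c%:P) ^+ m.+1 %| p -> ('X - c%:P) ^+ m %| p^`().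
Proof.
move=> /dvdpP[q ->]; rewrite derivM deriv_exp /= -mulr_natl.
by rewrite dvdp_add // ?exprS !dvdp_mull.
Qed.

Lemma flat_at_deriv p q c m (x : 'M[{poly R}]_(p, q)) :
  flat_at c m.+1 x -> flat_at c m (pderiv x).
Proof. by move=> xc i j; rewrite mxE dvdp_deriv_XsubC_exp. Qed.

Lemma flat_at_mull p q r c m (a : 'M[{poly R}]_(p, q))
    (x : 'M[{poly R}]_(q, r)) :
  flat_at c m x -> flat_at c m (a *m x).
Proof.
move=> xc i j; rewrite mxE; elim/big_ind: _ => [|y z|k _]; first exact: dvdp0.
  exact: dvdp_add.
exact: dvdp_mull.
Qed.

Lemma flat_at_leq p q c k m (x : 'M[{poly R}]_(p, q)) :
  (k <= m)%N -> flat_at c m x -> flat_at c k x.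
Proof. by move=> km xc i j; apply: dvdp_trans (xc i j); rewrite dvdp_exp2l. Qed.

Lemma flat_at_eval p q c m (x : 'M[{poly R}]_(p, q)) :
  flat_at c m.+1 x -> peval c x = 0.
Proof.
move=> xc; apply/matrixP => i j; rewrite !mxE.
exact: dvdp_XsubC_exp_root (xc i j).
Qed.

(** Up to the range of B, a forcing term A^(k+1) B g can be traded for
    A^k B g': this is the effect of subtracting A^k B g from y, as
    (D - A) (A^k B g) = A^k B g' - A^(k+1) B g. Each trade differentiates g
    once, so the resulting y involves the derivatives of g of order less
    than k. *)
Lemma forced_response n m (A : 'M[R]_n) (B : 'M[R]_(n, m)) k
    (g : 'cV[{poly R}]_m) :
  exists y v,
    pderiv y - pconst A *m y =
      pconst (iter k (mulmx A) B) *m g + pconst B *m v /\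
    forall c, flat_at c k g -> peval c y = 0.
Proof.
elim: k g => [|k IHk] g.
  exists 0, (- g); rewrite map_mx0 mulmx0 subr0 mulmxN subrr.
  by split=> // c _; rewrite map_mx0.
have [y [v [yE y0]]] := IHk (pderiv g).
exists (y - pconst (iter k (mulmx A) B) *m g), v; split.
  rewrite map_mxB /= pderiv_const_mul mulmxBr map_mxM /= -mulmxA.
  move/eqP: yE; rewrite subr_eq => /eqP->.
  set q := _ *m _ : 'cV__; set t := pconst B *m v; set r := pconst A *m y.
  by rewrite -(addrA q) (addrC q) addrK opprB addrA (addrAC _ r) addrK addrC.
move=> c gc; rewrite map_mxB /= y0 ?peval_const_mul.
  by rewrite (flat_at_eval gc) mulmx0 subrr.
exact: flat_at_deriv.
Qed.

(** The witness is the Taylor polynomial at c of the solution of x' = Ax: each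
    new term moves the error one power of X - c further. *)
Lemma truncated_flow n (A : 'M[R]_n) (x0 : 'cV[R]_n) c N :
  exists x : 'cV[{poly R}]_n,
    peval c x = x0 /\ flat_at c N (pderiv x - pconst A *m x).
Proof.
(* The error of a Taylor polynomial is a single monomial in X - c. *)
suff [x [xc [v xE]]] : exists x : 'cV[{poly R}]_n, peval c x = x0 /\
    exists v, pderiv x - pconst A *m x = ('X - c%:P) ^+ N *: pconst v.
  by exists x; split=> // i j; rewrite xE mxE dvdp_mulr.
elim: N => [|N [x [xc [v xE]]]].
  exists (pconst x0); split.
    by apply/matrixP => i j; rewrite !mxE horner_evalE hornerC.
  exists (- (A *m x0)); rewrite expr0 scale1r.
  rewrite map_mxN map_mxM /= -[RHS]add0r; congr (_ - _).
  by apply/matrixP => i j; rewrite !mxE derivC.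
pose e : 'cV_n := N.+1%:R^-1 *: v.
exists (x - ('X - c%:P) ^+ N.+1 *: pconst e); split.
  rewrite map_mxB /= xc [X in _ - X](@flat_at_eval _ _ _ N).
    by rewrite subr0.
  by move=> i j; rewrite mxE dvdp_mulr.
exists (A *m e).
have eE : pderiv (('X - c%:P) ^+ N.+1 *: pconst e) =
    ('X - c%:P) ^+ N *: pconst v.
  apply/matrixP => i j; rewrite !mxE derivM derivC mulr0 addr0.
  rewrite deriv_exp derivXsubC mul1r /=.
  rewrite -mulr_natl -polyC_natr mulrAC -polyCM mulrA divff ?pnatr_eq0 // mul1r.
  by rewrite mulrC.
rewrite map_mxB /= eE mulmxBr -xE -scalemxAr map_mxM /=.
by rewrite !subKr.
Qed.

(** A polynomial switch from 1 at a to 0 at b, flat at both points; it comes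
    from a Bezout relation between powers of X - a and X - b. *)
Lemma flat_step (a b : R) N : a != b ->
  exists h : {poly R}, ('X - b%:P) ^+ N %| h /\ ('X - a%:P) ^+ N %| 1 - h.
Proof.
move=> ab.
have /Bezout_eq1_coprimepP[[u v] /= uv] :
    coprimep (('X - a%:P) ^+ N) (('X - b%:P) ^+ N).
  by rewrite coprimep_expl // coprimep_expr // coprimep_XsubC root_XsubC eq_sym.
exists (v * ('X - b%:P) ^+ N); split; first by rewrite dvdp_mull.
by rewrite -uv addrK dvdp_mull.
Qed.

(** The Taylor curves through both end points are glued by a flat step h. The
    defect of the glued curve consists of the two defects, each weighted by
    the factor that is flat at the other point, and of a multiple of h'. *)
Lemma flat_connection n (A : 'M[R]_n) (x0 x1 : 'cV[R]_n) (a b : R) N :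
    a != b ->
  exists x : 'cV[{poly R}]_n, let f := pderiv x - pconst A *m x in
    [/\ peval a x = x0, peval b x = x1, flat_at a N f & flat_at b N f].
Proof.
move=> ab; have [p [pa pF]] := truncated_flow A x0 a N.
have [q [qb qF]] := truncated_flow A x1 b N.
(* One order more than N, as differentiating h loses one. *)
have [h [hb ha]] := flat_step N.+1 ab.
have ha' : ('X - a%:P) ^+ N %| h^`().
  rewrite -[h](subKr 1) derivB derivC sub0r dvdpNr.
  exact: dvdp_deriv_XsubC_exp.
have hb' := dvdp_deriv_XsubC_exp hb.
have hW c (r : {poly R}) : ('X - c%:P) ^+ N.+1 %| r -> ('X - c%:P) ^+ N %| r.
  by apply: dvdp_trans; rewrite dvdp_exp2l.
exists (h *: p + (1 - h) *: q).
have -> : pderiv (h *: p + (1 - h) *: q) - pconst A *m (h *: p + (1 - h) *: q) =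
    h *: (pderiv p - pconst A *m p) + (1 - h) *: (pderiv q - pconst A *m q) +
    h^`() *: (p - q).
  rewrite map_mxD /= !pderiv_scale derivB derivC sub0r.
  rewrite mulmxDr -!scalemxAr.
  apply/matrixP => i j; rewrite !mxE; ring.
have pevalZ c (r : {poly R}) (z : 'cV_n) :
    peval c (r *: z) = r.[c] *: peval c z.
  by apply/matrixP => i j; rewrite !mxE /= !horner_evalE hornerM.
have hE c : h.[c] = 1 - (1 - h).[c] by rewrite !hornerE subKr.
split=> /=.
- rewrite map_mxD /= !pevalZ hE (dvdp_XsubC_exp_root ha) pa.
  by rewrite subr0 scale1r scale0r addr0.
- rewrite map_mxD /= !pevalZ (dvdp_XsubC_exp_root hb) qb.
  by rewrite !hornerE (dvdp_XsubC_exp_root hb) subr0 scale1r scale0r add0r.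
- move=> i j; rewrite !mxE !dvdp_add ?[_ %| h^`() * _]dvdp_mulr //.
    by rewrite dvdp_mull //; have := pF i j; rewrite !mxE.
  by rewrite dvdp_mulr // hW.
- move=> i j; rewrite !mxE !dvdp_add ?[_ %| h^`() * _]dvdp_mulr //.
    by rewrite dvdp_mulr // hW.
  by rewrite dvdp_mull //; have := qF i j; rewrite !mxE.
Qed.

Lemma is_derive_peval p q (x : 'M[{poly R}]_(p, q)) (t : R) :
  is_derive t 1 (fun t : R => peval t x) (peval t (pderiv x)).
Proof.
have entry i j : (fun s => peval s x i j) = horner (x i j).
  by apply/funext => s; rewrite mxE.
have dx : derivable (fun t : R => peval t x) t 1.
  by apply/derivable_mxP => i j; rewrite entry; exact: derivable_horner.
split=> //; rewrite derive_mx //; apply/matrixP => i j; rewrite !mxE entry.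
by have [_ ->] := is_derive_poly (x i j) t.
Qed.

Lemma polynomial_trajectory n m (A : 'M[R]_n) (B : 'M[R]_(n, m)) x u :
  pderiv x = pconst A *m x + pconst B *m u ->
  trajectory A B (fun t : R => peval t u) (fun t => peval t x).
Proof.
move=> xE; split=> t; last first.
  have := is_derive_peval x t.
  by rewrite xE map_mxD /= !peval_const_mul.
apply: differentiable_continuous; apply/derivable1_diffP.
by have [] := is_derive_peval u t.
Qed.

(** A curve joining x0 to x1 with a defect f that is flat at both ends is
    corrected by the y with Dy - Ay = f + Bv; flatness of f makes y vanish at
    the ends. Any positive T would do for the steering time. *)
Lemma kalman_controllable n m (A : 'M[R]_n) (B : 'M[R]_(n, m)) N :
  (forall w : 'rV[R]_n,
    (forall k, (k < N)%N -> w *m iter k (mulmx A) B = 0) -> w = 0) ->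
  controllable_pair A B.
Proof.
move=> /kalman_right_inverse[K KE] x0 x1; exists 1; split; first exact: ltr01.
have neq01 : 0 != 1 :> R by rewrite eq_sym oner_eq0.
have [x [xa xb fa fb]] := flat_connection A x0 x1 N neq01.
set f := pderiv x - _ in fa fb.
have [y /fin_all_exists[v yP]] := fin_all_exists
  (fun k : 'I_N => forced_response A B k (pconst (K k) *m f)).
have y0 k c : flat_at c N f -> peval c (y k) = 0.
  by move=> fc; apply: (yP k).2; apply/flat_at_mull/(flat_at_leq _ fc)/ltnW.
have Y0 c : flat_at c N f -> peval c (\sum_k y k) = 0.
  by move=> fc; rewrite raddf_sum big1 // => k _; exact: y0.
exists (fun t : R => peval t (- \sum_k v k)),
  (fun t : R => peval t (x - \sum_k y k)).
split; first last.
- by rewrite map_mxB /= xb Y0 ?subr0.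
- by rewrite map_mxB /= xa Y0 ?subr0.
apply: polynomial_trajectory.
have YE : pderiv (\sum_k y k) - pconst A *m \sum_k y k =
    f + pconst B *m \sum_k v k.
  rewrite raddf_sum !mulmx_sumr -sumrB.
  rewrite (eq_bigr _ (fun k _ => (yP k).1)) big_split /=; congr (_ + _).
  under eq_bigr => k _ do rewrite mulmxA -map_mxM.
  by rewrite -mulmx_suml -raddf_sum KE /= map_mx1 mul1mx.
rewrite map_mxB /= mulmxBr mulmxN.
move/eqP: YE; rewrite subr_eq /f => /eqP->.
rewrite !opprD opprK !addrA subrr add0r.
exact: addrAC.
Qed.

End PolynomialTrajectories.

Theorem theorem15 (R : realType) (n : nat) (G : colored_digraph n)
    (VL : {set 'I_n}) :
  zero_forcing_set G VL -> controllable R G VL.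
Proof.
move=> VLzf A A_G; have [N NP] := zero_forcing_unobservable A_G VLzf.
exact: kalman_controllable NP.
Qed.
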